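(* Let $F,f,g$ be three real polynomials satisfying the following conditions. (a) $F(x)=a(x)f(x)+b(x)g(x)$, where $a(x),b(x)$ are two real polynomials, such that $\deg F=\deg f$ or $\deg F=\deg f+1$. (b) $f,g\in\mathrm{RZ}$ and $g\preceq f$. (c) $F$ and $g$ have leading coefficients of the same sign. Suppose that $b(r)\le 0$ whenever $f(r)=0$. Then $F\in\mathrm{RZ}$ and $f\preceq F$. In particular, if $g\prec f$ and $b(r)<0$ whenever $f(r)=0$, then $f\prec F$.
   Context: $\mathrm{RZ}$ denotes the set of real polynomials with only real zeros. For $f,g\in\mathrm{RZ}$, let $\{r_i\}$ and $\{s_j\}$ be all zeros (with multiplicity) of $f$ and $g$ respectively, in nonincreasing order. We say $g$ alternates left of $f$ (''$g$ alternates $f$'') if $\deg f=\deg g=n$ and $s_n\le r_n\le s_{n-1}\le\cdots\le s_2\le r_2\le s_1\le r_1$. We say $g$ interlaces $f$ if $\deg f=\deg g+1=n$ and $r_n\le s_{n-1}\le\cdots\le s_2\le r_2\le s_1\le r_1$. Write $g\preceq f$ for ''either $g$ alternates $f$ or $g$ interlaces $f$''. If no equality sign occurs in the respective chain of inequalities, $g$ strictly alternates (resp. strictly interlaces) $f$; write $g\prec f$ for ''either $g$ strictly alternates $f$ or $g$ strictly interlaces $f$''. By convention, $a\preceq bx+c$ for any real constants $a,b,c$, and $f\preceq 0$, $0\preceq f$ for any real polynomial $f$ with only real zeros. *)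

(* Defs.v *)
From mathcomp Require Import all_boot all_order all_algebra.
From mathcomp Require Import complex reals.

Set Implicit Arguments.
Unset Strict Implicit.
Unset Printing Implicit Defensive.

Import Order.TTheory GRing.Theory Num.Theory.
Local Open Scope ring_scope.

(* The zero polynomial is admitted, since the conventions f ⪯ 0 and 0 ⪯ f
   treat it as an element of RZ. *)
Definition RZ (R : realType) (p : {poly R}) : Prop :=
  p != 0 ->
  forall z : R[i], root (map_poly (real_complex R) p) z -> complex.Im z = 0.

(* For nonzero p in RZ, this determines s, and size s is the degree of p. *)
Definition zeros (R : realType) (p : {poly R}) (s : seq R) : Prop :=
  sorted >=%R s /\ forall x : R, count_mem x s = mup x p.

(* With s_i and r_i numbered from 1, this is the chain
   ... s_3 `le` r_3 `le` s_2 `le` r_2 `le` s_1 `le` r_1. It ends on the left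
   with s_n when size s = size r = n, and with r_n when
   size s + 1 = size r = n. *)
Definition chain (R : realType) (le : rel R) (s r : seq R) : Prop :=
  (forall i, (i < size s)%N -> le s`_i r`_i) /\
  (forall i, (i.+1 < size r)%N -> le r`_i.+1 s`_i).

Definition zeros_chain (R : realType) (le : rel R) (g f : {poly R}) : Prop :=
  exists s r : seq R, [/\ zeros g s, zeros f r & chain le s r].

Definition alternates_by (R : realType) (le : rel R) (g f : {poly R}) : Prop :=
  [/\ g != 0 /\ f != 0, RZ g /\ RZ f,
      size f = size g & zeros_chain le g f].

Definition interlaces_by (R : realType) (le : rel R) (g f : {poly R}) : Prop :=
  [/\ g != 0 /\ f != 0, RZ g /\ RZ f,
      size f = (size g).+1 & zeros_chain le g f].

Definition alternates (R : realType) := @alternates_by R <=%R.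
Definition interlaces (R : realType) := @interlaces_by R <=%R.
Definition strictly_alternates (R : realType) := @alternates_by R <%R.
Definition strictly_interlaces (R : realType) := @interlaces_by R <%R.

Definition preceq_conv (R : realType) (g f : {poly R}) : Prop :=
  [\/ exists a b c : R, g = a%:P /\ f = b *: 'X + c%:P,
      RZ g /\ f = 0
    | g = 0 /\ RZ f].

Definition preceq (R : realType) (g f : {poly R}) : Prop :=
  [\/ alternates g f, interlaces g f | preceq_conv g f].

Definition prec (R : realType) (g f : {poly R}) : Prop :=
  strictly_alternates g f \/ strictly_interlaces g f.

(* Main.v *)
(** Interlacing of root sequences is encoded by counting: [s] alternates left of
    or interlaces [r] iff every upward closed set contains as many entries of
    [r] as of [s], or exactly one more. In this form adding or deleting a common
    entry of [s] and [r] changes nothing. Take [g] and [F] with positive leading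
    coefficients. Common zeros of [f] and [g] may be
    divided out of [f], [g] and [F = a f + b g]; afterwards [f] has simple zeros
    c, and [g(c)] has sign (-1)^(k-1) when c is the k-th largest of them, whence
    [F(c) = b(c) g(c)] has sign (-1)^k or vanishes. Zeros shared by [f] and [F]
    are divided out in turn (the sign pattern survives), and for strict signs a
    parity count bounds the number of zeros of [F] above each c from both sides:
    it is k, and degree considerations leave no room for nonreal zeros.
    A common zero of [f] and [F] must be one of [b] or of [g], which gives the
    strict version. *)

Require Import Defs.
From mathcomp Require Import all_boot all_order all_algebra.
From mathcomp Require Import complex reals polyrcf.
From mathcomp Require Import zify ring.

Set Implicit Arguments.
Unset Strict Implicit.
Unset Printing Implicit Defensive.

Import Order.TTheory GRing.Theory Num.Theory.
Local Open Scope ring_scope.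

Local Notation prodXsub s := (\prod_(x <- s) ('X - x%:P)).

(** * Interlacing by counting, and its translation to chains of inequalities *)

Definition upward_closed (R : numDomainType) (P : pred R) : Prop :=
  forall x y : R, x <= y -> P x -> P y.

Definition interlacing (R : numDomainType) (s r : seq R) : Prop :=
  forall P : pred R, upward_closed P ->
    (count P s <= count P r <= (count P s).+1)%N.

Lemma upward_closed_ge (R : numDomainType) (x : R) : upward_closed (>= x).
Proof. by move=> y z yz xy; exact: le_trans xy yz. Qed.

Lemma interlacing_size (R : numDomainType) (s r : seq R) :
  interlacing s r -> (size s <= size r <= (size s).+1)%N.
Proof. by move/(_ predT); rewrite !count_predT; apply. Qed.

Lemma interlacing_perm (R : numDomainType) (s s' r r' : seq R) :
  perm_eq s s' -> perm_eq r r' -> interlacing s r -> interlacing s' r'.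
Proof.
by move=> /permP ss' /permP rr' sr P upP; rewrite -ss' -rr'; exact: sr.
Qed.

Lemma interlacing_cons (R : numDomainType) (c : R) (s r : seq R) :
  interlacing (c :: s) (c :: r) <-> interlacing s r.
Proof. by split=> sr P /sr /=; rewrite -addnS !leq_add2l. Qed.

(** In a nonincreasing list the entries lying in an upward closed set form a prefix. This turns
    statements about counts into statements about indices and back. *)
Lemma nth_upward_closed (R : numDomainType) (P : pred R) (s : seq R) (i : nat) :
  upward_closed P -> sorted >=%R s -> (i < size s)%N ->
  P s`_i = (i < count P s)%N.
Proof.
move=> upP; elim: s i => [//|x s IH] i /= xs; rewrite ltnS => lti.
have ss : sorted >=%R s by exact: path_sorted xs.
have /allP sx : all (>=%R x) s by exact: order_path_min ge_trans xs.
have [Px|nPx] := boolP (P x).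
  by case: i lti => [//|i] /IH ->.
have /eqP -> : count P s == 0%N.
  by rewrite -leqn0 leqNgt -has_count; apply/hasPn => y /sx yx;
     apply: contra nPx; exact: upP.
rewrite ltn0; case: i lti => [_|i lti]; first exact: negbTE.
by apply: contraNF nPx; apply: upP; apply: sx; exact: mem_nth.
Qed.

Lemma chain_interlacing (R : realType) (s r : seq R) :
  sorted >=%R s -> sorted >=%R r -> (size s <= size r <= (size s).+1)%N ->
  chain <=%R s r -> interlacing s r.
Proof.
move=> ss sr /andP[sz1 sz2] [c1 c2] P upP; apply/andP; split.
  case E: (count P s) => [//|k].
  have ks : (k < size s)%N by rewrite -E count_size.
  rewrite -nth_upward_closed //; last exact: leq_trans sz1.
  by apply: (upP _ _ (c1 k ks)); rewrite nth_upward_closed // E.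
case E: (count P r) => [//|[//|k]].
have kr : (k.+1 < size r)%N by rewrite -E count_size.
rewrite ltnS -nth_upward_closed //; last by rewrite -ltnS (leq_trans kr).
by apply: (upP _ _ (c2 k kr)); rewrite nth_upward_closed // E.
Qed.

(** Each inequality comes from testing the counts on one closed upper ray, starting at the entry
    that has to be the smaller one. *)
Lemma interlacing_chain (R : realType) (s r : seq R) :
  sorted >=%R s -> sorted >=%R r -> interlacing s r -> chain <=%R s r.
Proof.
move=> ss sr il; have := interlacing_size il => /andP[sz1 sz2].
split=> i ilt.
  have := il _ (@upward_closed_ge R s`_i) => /andP[+ _].
  have := nth_upward_closed (@upward_closed_ge R s`_i) ss ilt.
  rewrite lexx => /esym h /(leq_trans h) {}h.
  by rewrite (nth_upward_closed (@upward_closed_ge R s`_i) sr) // (leq_trans ilt).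
have := il _ (@upward_closed_ge R r`_i.+1) => /andP[_].
have := nth_upward_closed (@upward_closed_ge R r`_i.+1) sr ilt.
rewrite lexx => /esym h /(leq_trans h) {}h.
by rewrite (nth_upward_closed (@upward_closed_ge R r`_i.+1) ss) // -ltnS (leq_trans ilt).
Qed.

(** The entry [s_i] is strictly below [r_i], hence below all earlier entries of [r], and strictly
    above [r_(i+1)], hence above all later ones. *)
Lemma chain_lt_disjoint (R : realType) (s r : seq R) (x : R) :
  sorted >=%R r -> (size s <= size r)%N -> chain <%R s r ->
  x \in s -> x \notin r.
Proof.
move=> sr sz [c1 c2] /(nthP 0)[i ilt <-]; apply/negP => /(nthP 0)[j jlt E].
have [ji|ij] := leqP j i.
  have := sorted_leq_nth ge_trans (@lexx _ R) 0 sr.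
  move=> /(_ j i); rewrite !inE /= => /(_ jlt (leq_trans ilt sz) ji).
  by rewrite E leNgt c1.
have lt1 : (i.+1 < size r)%N by exact: leq_ltn_trans ij jlt.
have := sorted_leq_nth ge_trans (@lexx _ R) 0 sr.
move=> /(_ i.+1 j); rewrite !inE /= => /(_ lt1 jlt ij).
by rewrite E leNgt c2.
Qed.

Lemma chain_le_lt (R : realType) (s r : seq R) :
  (size s <= size r <= (size s).+1)%N -> (forall x, x \in s -> x \notin r) ->
  chain <=%R s r -> chain <%R s r.
Proof.
move=> /andP[sz1 sz2] dis [c1 c2]; split=> i ilt; rewrite lt_neqAle.
  rewrite c1 // andbT; apply: contra (dis _ (mem_nth 0 ilt)) => /eqP ->.
  by rewrite mem_nth // (leq_trans ilt).
rewrite c2 // andbT; have ls : (i < size s)%N by rewrite -ltnS (leq_trans ilt).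
by apply: contra (dis _ (mem_nth 0 ls)) => /eqP <-; rewrite mem_nth.
Qed.

(** * Signs of products of linear factors and of polynomials without real roots *)

Lemma sign_le_subr_gt0 (R : realDomainType) (x y : R) :
  x != y -> 0 < (-1) ^+ (x <= y)%R * (x - y).
Proof.
case: (ltgtP x y) => // xy _; first by rewrite mulN1r opprB subr_gt0.
by rewrite mul1r subr_gt0.
Qed.

Lemma prodXsub_sign (R : realDomainType) (s : seq R) (x : R) :
  x \notin s -> 0 < (-1) ^+ count (>= x) s * (prodXsub s).[x].
Proof.
elim: s => [|y s IH]; first by rewrite big_nil hornerC mulr1.
rewrite inE negb_or => /andP[xy /IH h].
rewrite big_cons hornerM hornerXsubC /= exprD mulrACA pmulr_lgt0 //.
exact: sign_le_subr_gt0.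
Qed.

Lemma rootless_gt0 (R : rcfType) (q : {poly R}) (x : R) :
  0 < lead_coef q -> (forall y, ~~ root q y) -> 0 < q.[x].
Proof.
move=> lq nq; have := @sgp_pinftyP _ x q (fun y _ => nq y) x.
rewrite in_itv /= lexx => /(_ isT); rewrite /sgp_pinfty (gtr0_sg lq) => /eqP.
by rewrite sgr_cp0.
Qed.

(** Without real roots the sign at minus infinity agrees with the positive sign at plus infinity, so
    the degree is even. *)
Lemma rootless_odd_size (R : rcfType) (q : {poly R}) :
  0 < lead_coef q -> (forall y, ~~ root q y) -> odd (size q).
Proof.
move=> lq nq; have := @sgp_minftyP _ 0 q (fun y _ => nq y) 0.
rewrite in_itv /= lexx => /(_ isT).
rewrite gtr0_sg ?rootless_gt0 // /sgp_minfty sgrM (gtr0_sg lq) mulr1 => /esym/eqP.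
rewrite sgr_cp0 -signr_odd; have : (0 < size q)%N.
  by rewrite lt0n size_poly_eq0 -lead_coef_eq0 gt_eqF.
by case: (size q) => //= n _; case: odd => //; rewrite expr1 oppr_gt0 ltr10.
Qed.

Lemma rootless_factorization (R : rcfType) (p : {poly R}) :
  p != 0 -> exists q (t : seq R), p = q * prodXsub t /\ forall x, ~~ root q x.
Proof.
elim: {p}(size p) {-2}p (leqnn (size p)) => [|n IH] p.
  by rewrite leqn0 size_poly_eq0 => ->.
move=> szp p0.
have rp x : (x \in rootsR p) = root p x by rewrite -(roots_on_rootsR p0 x).
case E: (rootsR p) => [|x rs].
  by exists p, [::]; rewrite big_nil mulr1; split=> // x; rewrite -rp E.
have : x \in rootsR p by rewrite E mem_head.
rewrite rp => /factor_theorem[p1 Ep].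
have p10 : p1 != 0 by apply: contraNneq p0 => p10; rewrite Ep p10 mul0r.
have [|q [t [Ep1 nq]]] := IH p1 _ p10.
  by move: szp; rewrite Ep size_Mmonic ?monicXsubC // size_XsubC addnC.
by exists q, (x :: t); rewrite big_cons mulrCA -Ep1 mulrC.
Qed.

(** * Root interlacing deduced from sign patterns *)

Lemma strictly_alternating_signs (R : rcfType) (r : seq R) (F : {poly R}) :
  sorted >%R r -> 0 < lead_coef F ->
  size F = (size r).+1 \/ size F = (size r).+2 ->
  (forall i, (i < size r)%N -> 0 < (-1) ^+ i.+1 * F.[r`_i]) ->
  exists t, F = lead_coef F *: prodXsub t /\ interlacing r t.
Proof.
move=> sr lF szF sgF.
have F0 : F != 0 by rewrite -lead_coef_eq0 gt_eqF.
have [q [t [EF nq]]] := rootless_factorization F0.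
have mt : prodXsub t \is monic by exact: monic_prod_XsubC.
have lq : 0 < lead_coef q by rewrite EF lead_coef_Mmonic in lF.
have oq := rootless_odd_size lq nq.
have q0 : q != 0 by rewrite -lead_coef_eq0 gt_eqF.
have szqt : size F = (size q + size t)%N.
  by rewrite EF size_Mmonic // size_prod_XsubC addnS.
have sr' : sorted >=%R r by apply: sub_sorted sr => x y /ltW.
(* The goal is [N i = i.+1] for every index [i] of [r], counted from 0; parity comes first, then the
   two bounds. *)
pose N i := count (>= r`_i) t.
have par i : (i < size r)%N -> odd (N i) = odd i.+1.
  move=> /sgF; set x := r`_i => sgx.
  have xt : x \notin t.
    apply: contraTN sgx => xt; suff /eqP -> : F.[x] == 0 by rewrite mulr0 ltxx.
    by rewrite -/(root F x) EF rootM root_prod_XsubC xt orbT.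
  have := prodXsub_sign xt; rewrite -/(N i) => sgt.
  have := mulr_gt0 sgx (mulr_gt0 sgt (rootless_gt0 x lq nq)).
  rewrite EF hornerM; set u := q.[x]; set v := horner _ _.
  (* The product of three positive numbers is a square up to the sign [(-1) ^+ (i.+1 + N i)], so
     this exponent is even. *)
  have -> : (-1) ^+ i.+1 * (u * v) * ((-1) ^+ N i * v * u)
            = (-1) ^+ (i.+1 + N i) * (u * v) ^+ 2 by rewrite exprD; ring.
  rewrite -signr_odd oddD; case: (odd i.+1); case: (odd (N i)) => //=;
    by rewrite expr1 mulN1r oppr_gt0 ltNge sqr_ge0.
have Nmono i : (i.+1 < size r)%N -> (N i <= N i.+1)%N.
  move=> ilt; apply: sub_count => y /=; apply: le_trans.
  by have /(sortedP 0)/(_ i ilt) := sr'.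
(* [N] is nondecreasing, starts odd and changes parity at each step, so it grows by at least one
   each time. *)
have Nlo i : (i < size r)%N -> (i < N i)%N.
  elim: i => [|i IH] ilt; have := par _ ilt; first by case: (N _).
  by have := Nmono _ ilt; have := IH (ltnW ilt); lia.
have szt : (size r <= size t)%N.
  case E: (size r) => [//|n]; have := Nlo n; rewrite E => /(_ (ltnSn _)) h.
  by apply: leq_trans h _; exact: count_size.
(* Since [t] is at least as long as [r], the degree bound leaves [size q <= 2]; being odd, [size q]
   is 1. *)
have [szt2 szt3] : size q = 1%N /\ (size t <= (size r).+1)%N.
  by move: oq szqt szF szt; move: (size q) (size t) (size F) (size r) => *; lia.
(* Induction backwards from the last index, with [k] the number of later entries. Each bound first
   comes out as [i.+2], and parity lowers it by one. *)
have Nhi k i : (i + k.+1 = size r)%N -> (N i <= i.+1)%N.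
  elim: k i => [|k IH] i ik.
    have := par i; have : (N i <= size t)%N by exact: count_size.
    by lia.
  have lt1 : (i.+1 < size r)%N by lia.
  by have := IH i.+1; have := Nmono _ lt1; have := par i (ltnW lt1); lia.
exists t; split.
  have /size_poly1P[c c0 Eq] : size q == 1%N by rewrite szt2.
  by rewrite {1}EF EF lead_coef_Mmonic // Eq lead_coefC mul_polyC.
move=> P upP; apply/andP; split.
  case E: (count P r) => [//|k].
  have ks : (k < size r)%N by rewrite -E count_size.
  apply: leq_trans (Nlo k ks) _; apply: sub_count => y /= h; apply: (upP _ _ h).
  by rewrite nth_upward_closed // E.
(* If some entry of [r] lies outside [P], the largest such has index [count P r], and all entries of
   [t] in [P] lie above it. *)
have [kr|kr] := ltnP (count P r) (size r); last first.
  by rewrite (leq_trans (count_size _ _)) // (leq_trans szt3).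
have [k Ek] : exists k, (count P r + k.+1 = size r)%N.
  by exists (size r - (count P r).+1)%N; lia.
apply: leq_trans (Nhi _ _ Ek); apply: sub_count => y /= Py.
rewrite leNgt; apply/negP => /ltW /upP /(_ Py).
by rewrite nth_upward_closed // ltnn.
Qed.

(** The weak form of the sign criterion: induction on the length of [r] removes the zeros of [F] in
    [r] until all signs are strict. *)
Lemma alternating_signs (R : rcfType) (r : seq R) (F : {poly R}) :
  uniq r -> 0 < lead_coef F ->
  size F = (size r).+1 \/ size F = (size r).+2 ->
  (forall c, c \in r -> 0 <= (-1) ^+ count (>= c) r * F.[c]) ->
  exists t, F = lead_coef F *: prodXsub t /\ interlacing r t.
Proof.
elim: {r}(size r) {-2}r (erefl (size r)) F => [|n IH] r szr F ur lF szF sgF.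
  apply: strictly_alternating_signs => //; case: r szr {ur szF sgF} => //.
have [/hasP[c cr rc]|/hasPn nr] := boolP (has (root F) r); last first.
  pose r' := rev (sort <=%R r).
  have prr : perm_eq r' r by rewrite perm_rev perm_sort.
  have str : sorted >%R r' by rewrite rev_sorted sort_lt_sorted.
  have sr : sorted >=%R r' by apply: sub_sorted str => x y /ltW.
  have [||t [Et il]] := strictly_alternating_signs str lF.
  - by rewrite (perm_size prr).
  - move=> i ilt; have ir : r'`_i \in r by rewrite -(perm_mem prr) mem_nth.
    have := sgF _ ir; rewrite le_eqVlt eq_sym mulf_eq0 signr_eq0 /=.
    rewrite -/(root F _) (negbTE (nr _ ir)) /=.
    (* Because [r'] is strictly decreasing, the number of entries at or above one of them is its
       rank counted from 1. *)
    suff -> : count (>= r'`_i) r = i.+1 by [].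
    rewrite -(permP prr); apply/eqP; rewrite eqn_leq.
    have up := @upward_closed_ge R r'`_i.
    rewrite -(nth_upward_closed up sr ilt) lexx andbT.
    have [lt1|] := ltnP i.+1 (size r').
      rewrite leqNgt -(nth_upward_closed up sr lt1) -ltNge.
      by have /(sortedP 0)/(_ i lt1) := str.
    by apply: leq_trans; exact: count_size.
  exists t; split=> //; exact: interlacing_perm prr (perm_refl _) il.
have pr := perm_to_rem cr; set r' := rem c r in pr.
have [F1 EF] := factor_theorem _ _ rc.
have lF1 : lead_coef F = lead_coef F1 by rewrite EF lead_coef_Mmonic ?monicXsubC.
have F10 : F1 != 0 by rewrite -lead_coef_eq0 -lF1 gt_eqF.
have szF1 : size F = (size F1).+1.
  by rewrite EF size_Mmonic ?monicXsubC // size_XsubC addnC.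
have szr' : size r' = n by rewrite size_rem // szr.
have ur' : uniq r' by exact: rem_uniq.
have cr' : c \notin r' by rewrite mem_rem_uniqF.
have [|||t [Et il]] := IH r' szr' F1 ur'.
- by rewrite -lF1.
- by move: szF; rewrite szr' szF1 szr => -[[->]|[->]]; [left|right].
- move=> d dr'; have dr : d \in r by exact: mem_rem dr'.
  have dc : d != c by apply: contraNneq cr' => <-.
  (* Dropping [c] changes the exponent by 1 exactly when [d <= c], which is when the cancelled
     factor [d - c] is negative. *)
  have := sgF _ dr; rewrite (permP pr) /= EF hornerM hornerXsubC exprD.
  rewrite [F1.[d] * _]mulrC mulrACA.
  by rewrite pmulr_rge0 // sign_le_subr_gt0.
exists (c :: t); split.
  by rewrite lF1 big_cons {1}EF {1}Et -scalerAl mulrC.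
apply: interlacing_perm (perm_refl _) _; first by rewrite perm_sym; exact: pr.
exact/interlacing_cons.
Qed.

Lemma interlacing_combination (R : rcfType) (s r : seq R) (F a b : {poly R}) :
  interlacing s r -> 0 < lead_coef F ->
  size F = (size r).+1 \/ size F = (size r).+2 ->
  F = a * prodXsub r + b * prodXsub s ->
  (forall c, c \in r -> b.[c] <= 0) ->
  exists t, F = lead_coef F *: prodXsub t /\ interlacing r t.
Proof.
elim: {r}(size r) {-2}r (erefl (size r)) s F => [|n IH] r szr s F il lF szF EF br.
  by apply: alternating_signs => //; case: r szr {il szF EF br}.
have [/hasP[c cr cs]|/hasPn ns] := boolP (has (mem s) r).
  have pr := perm_to_rem cr; have ps := perm_to_rem cs.
  set r' := rem c r in pr; set s' := rem c s in ps.
  have szr' : size r' = n by rewrite size_rem // szr.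
  pose F1 := a * prodXsub r' + b * prodXsub s'.
  have EF1 : F = F1 * ('X - c%:P).
    by rewrite EF (perm_big _ pr) (perm_big _ ps) !big_cons /=; rewrite /F1; ring.
  have lF1 : lead_coef F = lead_coef F1 by rewrite EF1 lead_coef_Mmonic ?monicXsubC.
  have F10 : F1 != 0 by rewrite -lead_coef_eq0 -lF1 gt_eqF.
  have szF1 : size F = (size F1).+1.
    by rewrite EF1 size_Mmonic ?monicXsubC // size_XsubC addnC.
  have [|||||t [Et il']] := IH r' szr' s' F1.
  - by apply/(interlacing_cons c); exact: interlacing_perm ps pr il.
  - by rewrite -lF1.
  - by move: szF; rewrite szr' szF1 szr => -[[->]|[->]]; [left|right].
  - by [].
  - by move=> d /mem_rem; exact: br.
  exists (c :: t); split.
    by rewrite lF1 big_cons {1}EF1 {1}Et -scalerAl mulrC.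
  apply: interlacing_perm (perm_refl _) _; first by rewrite perm_sym; exact: pr.
  exact/interlacing_cons.
(* Compare the closed and open upper rays at [c]. They hold equally many entries of [s], while the
   counts for [r] differ by the multiplicity of [c]; both lie in the same window of two values, so
   the multiplicity is 1 and the closed count is the larger value. *)
have cnt c : c \in r -> count_mem c r = 1%N /\ count (>= c) r = (count (>= c) s).+1.
  move=> cr; have h1 := il _ (@upward_closed_ge R c).
  have h2 := il (> c) (fun x y xy cx => lt_le_trans cx xy).
  have spl (u : seq R) : count (>= c) u = (count_mem c u + count (> c) u)%N.
    rewrite -[RHS]subn0 -(count_predUI (pred1 c) (> c) u).
    rewrite [X in (_ + X)%N](_ : _ = 0%N) ?addn0 ?subn0.
      by apply: eq_count => x /=; rewrite le_eqVlt eq_sym.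
    rewrite (eq_count (a2 := pred0)) ?count_pred0 // => x /=.
    by case: eqVneq => //= ->; rewrite ltxx.
  have : (0 < count_mem c r)%N by rewrite -has_count has_pred1.
  have : count_mem c s = 0%N by apply/count_memPn; exact: ns.
  move: h1 h2; rewrite !spl; move: (count_mem c r) (count_mem c s).
  by move: (count (> c) r) (count (> c) s) => u v w z; lia.
apply: alternating_signs => //.
  by apply/(@count_mem_uniq R) => x; have [/cnt[]//|/count_memPn] := boolP (x \in r).
move=> c cr; have [_ ->] := cnt _ cr.
have := prodXsub_sign (ns _ cr); rewrite EF hornerD !hornerM.
have /eqP -> : (prodXsub r).[c] == 0 by rewrite -/(root _ _) root_prod_XsubC.
(* The extra factor -1 from the larger exponent is paired with [b.[c] <= 0]. *)
rewrite mulr0 add0r exprS mulrACA mulN1r => h.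
by apply: mulr_ge0; [rewrite oppr_ge0 br|exact: ltW].
Qed.

(** * Passing between real-rooted polynomials and their lists of zeros *)

Lemma RZ_scale_prodXsub (R : realType) (c : R) (s : seq R) :
  RZ (c *: prodXsub s).
Proof.
move=> p0; have c0 : c != 0 by apply: contraNneq p0 => ->; rewrite scale0r.
move=> z; rewrite linearZ /= rootZ ?fmorph_eq0 // rmorph_prod /=.
under eq_bigr do rewrite map_polyXsubC.
by rewrite -(big_map _ predT (fun w => 'X - w%:P)) root_prod_XsubC => /mapP[x _ ->].
Qed.

(** If the factor without real roots were not constant, it would have a complex root, which [RZ]
    forces to be real. *)
Lemma RZ_factorization (R : realType) (p : {poly R}) :
  p != 0 -> RZ p -> exists s, sorted >=%R s /\ p = lead_coef p *: prodXsub s.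
Proof.
move=> p0 /(_ p0) pRZ; have [q [t [Ep nq]]] := rootless_factorization p0.
have szq : size q = 1%N.
  apply/eqP; rewrite -(size_map_poly (real_complex R)).
  apply: contraT => /closed_rootP[z qz].
  have zr : complex.Im z = 0 by apply: pRZ; rewrite Ep rmorphM /= rootM qz.
  case: z zr qz => x y /= -> qz.
  by have := nq x; rewrite -(fmorph_root (real_complex R)) => /negP/(_ qz).
exists (rev (sort <=%R t)); split; first by rewrite rev_sorted sort_le_sorted.
have /permP ptr : perm_eq (rev (sort <=%R t)) t by rewrite perm_rev perm_sort.
rewrite (perm_big t); last exact/permP.
have /size_poly1P[c _ Eq] : size q == 1%N by rewrite szq.
by rewrite {1}Ep Ep lead_coef_Mmonic ?monic_prod_XsubC // Eq lead_coefC mul_polyC.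
Qed.

Lemma zeros_scale_prodXsub (R : realType) (c : R) (s : seq R) :
  c != 0 -> sorted >=%R s -> zeros (c *: prodXsub s) s.
Proof.
move=> c0 ss; split=> // x.
by rewrite -mul_polyC mupMr ?rootC // mu_prod_XsubC.
Qed.

Lemma zeros_inj (R : realType) (p : {poly R}) (s s' : seq R) :
  zeros p s -> zeros p s' -> s = s'.
Proof.
move=> [ss cs] [ss' cs']; apply: (sorted_eq ge_trans ge_anti ss ss').
by apply/allP => x _ /=; rewrite cs cs'.
Qed.

Lemma preceq_interlacing (R : realType) (g f : {poly R}) :
  g != 0 -> f != 0 -> RZ g -> RZ f -> preceq g f ->
  exists s r, [/\ sorted >=%R s, sorted >=%R r, g = lead_coef g *: prodXsub s,
    f = lead_coef f *: prodXsub r & interlacing s r].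
Proof.
move=> g0 f0 hg hf gf.
have [s [ss Eg]] := RZ_factorization g0 hg.
have [r [sr Ef]] := RZ_factorization f0 hf.
exists s, r; split=> //.
have szg : size g = (size s).+1.
  by rewrite Eg size_scale ?lead_coef_eq0 // size_prod_XsubC.
have szf : size f = (size r).+1.
  by rewrite Ef size_scale ?lead_coef_eq0 // size_prod_XsubC.
have zs : zeros g s by rewrite Eg; apply: zeros_scale_prodXsub; rewrite ?lead_coef_eq0.
have zr : zeros f r by rewrite Ef; apply: zeros_scale_prodXsub; rewrite ?lead_coef_eq0.
have chains : (size s <= size r <= (size s).+1)%N ->
    zeros_chain <=%R g f -> interlacing s r.
  move=> sz [s' [r' [zs' zr' ch]]]; apply: chain_interlacing => //.
  by rewrite (zeros_inj zs zs') (zeros_inj zr zr').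
case: gf => [[_ _ sz]|[_ _ sz]|[[a [b [c [ga fbc]]]]|[_ f00]|[g00 _]]].
- by apply: chains; move: sz; rewrite szg szf => -[->]; rewrite leqnn leqnSn.
- by apply: chains; move: sz; rewrite szg szf => -[->]; rewrite leqnn leqnSn.
(* The convention for a constant and a polynomial of degree at most one: [s] is empty and [r] has at
   most one entry, so the counts always fit. *)
- have s0 : s = [::].
    have : (size g <= 1)%N by rewrite ga size_polyC_leq1.
    by rewrite szg; case: (s).
  have r1 : (size r <= 1)%N.
    rewrite -ltnS -szf fbc (leq_trans (size_polyD _ _)) // geq_max.
    rewrite (leq_trans (size_scale_leq _ _)) ?size_polyX //.
    exact: leq_trans (size_polyC_leq1 _) _.
  by move=> P _; rewrite s0 /= (leq_trans (count_size _ _)).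
- by rewrite f00 eqxx in f0.
- by rewrite g00 eqxx in g0.
Qed.

Theorem theorem2p1 (R : realType) (F f g a b : {poly R})
    (hF : F = a * f + b * g)
    (hdeg : size F = size f \/ size F = (size f).+1)
    (hf : RZ f) (hg : RZ g)
    (hgf : preceq g f)
    (hlc : Num.sg (lead_coef F) = Num.sg (lead_coef g))
    (hb : forall r : R, f.[r] = 0 -> b.[r] <= 0) :
  [/\ RZ F,
      preceq f F
    & prec g f -> (forall r : R, f.[r] = 0 -> b.[r] < 0) -> prec f F].
Proof.
have nprec0 : g = 0 \/ f = 0 -> ~ prec g f.
  by case=> -> [] [[g0 f0]] _ _ _; [move: g0|move: g0|move: f0|move: f0]; rewrite eqxx.
have [f0|f0] := eqVneq f 0.
  have szF : (size F <= 1)%N by move: hdeg; rewrite f0 size_poly0 => -[] ->.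
  have RF : RZ F.
    have -> : F = F`_0 *: prodXsub ([::] : seq R).
      by rewrite big_nil -mul_polyC mulr1; exact: size1_polyC.
    exact: RZ_scale_prodXsub.
  split=> //; first by apply: Or33; exact: Or33.
  by move=> gf; case: (nprec0 (or_intror f0) gf).
have [g0|g0] := eqVneq g 0.
  (* The sign of the zero leading coefficient is 0, so the sign hypothesis makes [F] vanish too. *)
  have F0 : F = 0.
    by apply/eqP; rewrite -lead_coef_eq0 -sgr_eq0 hlc g0 lead_coef0 sgr0.
  split; first by move=> /eqP/(_ F0).
    by apply: Or33; exact: Or32.
  by move=> gf; case: (nprec0 (or_introl g0) gf).
have [s [r [ss sr Eg Ef il]]] := preceq_interlacing g0 f0 hg hf hgf.
set d := lead_coef g in hlc Eg; have d0 : d != 0 by rewrite lead_coef_eq0.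
set c := lead_coef f in Ef; have c0 : c != 0 by rewrite lead_coef_eq0.
have F0 : F != 0 by rewrite -lead_coef_eq0 -sgr_eq0 hlc sgr_eq0.
have szf : size f = (size r).+1 by rewrite Ef size_scale // size_prod_XsubC.
have rootf x : (f.[x] == 0) = (x \in r).
  by rewrite -/(root f x) Ef rootZ // root_prod_XsubC.
(* Dividing by [d] makes the leading coefficient of [F] positive and [g] monic. The constant [c] of
   [f] moves into [a], so [b] and its sign condition stay unchanged. *)
have [||||t [Et ilt]] :=
  @interlacing_combination R s r (d^-1 *: F) ((d^-1 * c) *: a) b il.
- by rewrite lead_coefZ -sgr_cp0 sgrM hlc -sgrM mulVf // sgr1.
- by rewrite size_scale ?invr_eq0 // -szf.
- rewrite {1}hF {1}Ef {1}Eg scalerDr -!scalerAr !scalerA mulVf // scale1r.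
  by rewrite -scalerAl.
- by move=> x; rewrite -rootf => /eqP; exact: hb.
have {}Et : F = lead_coef F *: prodXsub t.
  have := congr1 (GRing.scale d) Et.
  by rewrite lead_coefZ !scalerA mulrA mulfV // mul1r scale1r.
pose t' := rev (sort <=%R t).
have ptt : perm_eq t t' by rewrite perm_sym perm_rev perm_sort.
have st' : sorted >=%R t' by rewrite rev_sorted sort_le_sorted.
have {}ilt : interlacing r t' by exact: interlacing_perm (perm_refl r) ptt ilt.
have {ptt}Et' : F = lead_coef F *: prodXsub t' by rewrite -(perm_big _ ptt).
have lF0 : lead_coef F != 0 by rewrite lead_coef_eq0.
have RF : RZ F by rewrite Et'; exact: RZ_scale_prodXsub.
have zf : zeros f r by rewrite Ef; exact: zeros_scale_prodXsub.
have zF : zeros F t' by rewrite Et'; exact: zeros_scale_prodXsub.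
have leFt := interlacing_chain sr st' ilt.
have szrt := interlacing_size ilt.
split=> //.
  have zc : zeros_chain <=%R f F by exists r, t'.
  by case: hdeg => sz; [apply: Or31|apply: Or32].
move=> gf hb'.
have szsr := interlacing_size il.
have ltsr : chain <%R s r.
  have zs : zeros g s by rewrite Eg; exact: zeros_scale_prodXsub.
  by case: gf => -[_ _ _ [s' [r' [zs' zr' ch]]]];
    rewrite (zeros_inj zs zs') (zeros_inj zf zr').
have zc : zeros_chain <%R f F.
  (* At a common zero of [f] and [F] the product [b * g] vanishes; [b] is negative there, so [g]
     would share a zero with [f], against the strict chain. *)
  exists r, t'; split=> //; apply: chain_le_lt => // x xr; apply/negP => xt.
  have fx : f.[x] = 0 by apply/eqP; rewrite rootf.
  have Fx : F.[x] = 0.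
    by apply/eqP; rewrite -/(root F x) Et' rootZ // root_prod_XsubC.
  move: Fx; rewrite hF hornerD !hornerM fx mulr0 add0r => /eqP.
  rewrite mulf_eq0 lt_eqF ?hb' //= -/(root g x) Eg rootZ // root_prod_XsubC => xs.
  have /andP[szs _] := szsr.
  by have := chain_lt_disjoint sr szs ltsr xs; rewrite xr.
by case: hdeg => sz; [left|right].
Qed.
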